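(* Let $\mathbf{k}$ be a field of characteristic zero, let $A=\mathbf{k}[z;\lambda,0,\varphi(z)]$ with $\lambda\neq1$, and let $F_1$ be the Hochschild $2$-cocycle corresponding to $f(z)$. There exists a unique family of $\mathbf{k}$-bilinear maps $F_n\colon A\times A\to A$, $n\geq2$, integrating $F_1$, such that each $F_n$ satisfies, for all $u,v\in A$, (a) $F_n(u,1)=F_n(1,v)=0$; (b) $F_n(zu,v)=zF_n(u,v)$, and $F_n(x^q,x^j)=F_n(y^q,y^j)=0$ for all $q,j$; and which are determined by $$F_n(x,z)=0,\quad F_n(y,z)=yz,\quad F_n(x,y)=\frac{(-1)^n}{n!}z^n\bar\varphi^{(n)}(z),\quad F_n(y,x)=0\qquad(n\ge2).$$ Moreover, the $F_n$ preserve $\Gamma$.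
   Context: Let $\lambda\in\mathbf{k}^\times$, $0\neq\varphi(z)\in\mathbf{k}[z]$ of degree $l$, and $\sigma$ the automorphism of $\mathbf{k}[z]$ with $\sigma(z)=\lambda z$. The algebra $A=\mathbf{k}[z;\lambda,0,\varphi(z)]$ is generated by $x,y,z$ subject to $xz=\lambda zx$, $yz=\lambda^{-1}zy$, $yx=\varphi(z)$, $xy=\sigma(\varphi(z))$. Write $\bar\varphi(z)=\sigma(\varphi(z))=\varphi(\lambda z)$; $\bar\varphi^{(n)}$ is its $n$-th derivative. For bilinear $F\colon A\times A\to A$, $\mathsf{b}F(a_1,a_2,a_3)=a_1F(a_2,a_3)-F(a_1a_2,a_3)+F(a_1,a_2a_3)-F(a_1,a_2)a_3$; $F$ is a Hochschild $2$-cocycle if $\mathsf{b}F=0$. Put $F\bullet G(a_1,a_2,a_3)=F(G(a_1,a_2),a_3)-F(a_1,G(a_2,a_3))$. Maps $F_2,F_3,\dots$ integrate $F_1$ if $\sum_{i=1}^{n-1}F_i\bullet F_{n-i}=\mathsf{b}F_n$ for all $n\ge2$. For $m\in A$, $f(m)=(\lambda mx,-ym,0,-\lambda\,{}^\sigma\Delta^\sigma(\varphi)\cdot m)\in A^{\oplus4}$, where for $\varphi=\sum_ia_iz^i$, ${}^\sigma\Delta^\sigma(\varphi)\cdot m=\sum_{i\ge1}a_i\sum_{j=1}^i\sigma(z)^{i-j}m\sigma(z)^{j-1}$; it is a $2$-cocycle in a periodic complex computing Hochschild cohomology. The Hochschild $2$-cocycle $F_1$ corresponding to $f(z)$ (via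 an explicit comparison with the bar resolution) is, concretely, the unique Hochschild $2$-cocycle satisfying (a), (b) (with $F_1$ in place of $F_n$) and $F_1(x,z)=-xz$, $F_1(y,z)=yz$, $F_1(x,y)=-z\bar\varphi'(z)$, $F_1(y,x)=0$. Filtration $\Gamma$: let $x_q=x^q$ for $q\ge0$ and $x_q=y^{-q}$ for $q<0$; $\mathcal{B}=\{z^px_q\mid p\ge0,q\in\mathbb{Z}\}$ is a basis of $A$. Put $\|z^px_q\|=p+(l+1)|q|$ and $\Gamma^nA=\operatorname{span}_{\mathbf{k}}\{b\in\mathcal{B}:\|b\|\le n\}$. A bilinear map $F$ preserves $\Gamma$ if $F(b_1,b_2)\in\Gamma^{\|b_1\|+\|b_2\|}A$ for all $b_1,b_2\in\mathcal{B}$. *)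

(* Defs.v *)
From HB Require Import structures.
From mathcomp Require Import all_boot all_order all_algebra.

Set Implicit Arguments.
Unset Strict Implicit.
Unset Printing Implicit Defensive.

Import GRing.Theory.
Local Open Scope ring_scope.

Section Defs.
Variables (k : fieldType) (lam : k) (phi : {poly k}).


Definition sigma (p : {poly k}) : {poly k} := p \Po (lam *: 'X).

(* Polynomials in z are evaluated in a k-algebra with [horner_alg z]. *)
Definition gwa_relations (A : algType k) (x y z : A) : Prop :=
  [/\ x * z = lam *: (z * x),
      y * z = lam^-1 *: (z * y),
      y * x = horner_alg z phi
    & x * y = horner_alg z (sigma phi)].

(* A is the algebra k[z; lam, 0, phi], i.e. it is generated by x, y, z subject
   to exactly the relations above: this is the universal property of the
   quotient of the free algebra k<x, y, z>. *)
Definition is_gwa (A : algType k) (x y z : A) : Prop :=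
  gwa_relations x y z /\
  forall (B : algType k) (x' y' z' : B), gwa_relations x' y' z' ->
    exists f : {lrmorphism A -> B},
      [/\ f x = x', f y = y' & f z = z'] /\
      forall g : {lrmorphism A -> B},
        [/\ g x = x', g y = y' & g z = z'] -> g =1 f.

Variables (A : algType k) (x y z : A).

Definition hochschild_b (F : A -> A -> A) (a1 a2 a3 : A) : A :=
  a1 * F a2 a3 - F (a1 * a2) a3 + F a1 (a2 * a3) - F a1 a2 * a3.

Definition cocycle2 (F : A -> A -> A) : Prop :=
  forall a1 a2 a3, hochschild_b F a1 a2 a3 = 0.

Definition bullet (F G : A -> A -> A) (a1 a2 a3 : A) : A :=
  F (G a1 a2) a3 - F a1 (G a2 a3).

(* F i is F_i for i >= 1, with first term the prescribed F1; F 0 is unused. *)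
Definition integrates (F1 : A -> A -> A) (F : nat -> {bilinear A -> A -> A})
    : Prop :=
  F 1%N =2 F1 /\
  forall n : nat, (2 <= n)%N -> forall a1 a2 a3 : A,
    \sum_(1 <= i < n) bullet (F i) (F (n - i)%N) a1 a2 a3
      = hochschild_b (F n) a1 a2 a3.

Definition cond_a (F : A -> A -> A) : Prop :=
  forall u v : A, F u 1 = 0 /\ F 1 v = 0.

Definition cond_b (F : A -> A -> A) : Prop :=
  (forall u v : A, F (z * u) v = z * F u v) /\
  (forall q j : nat, F (x ^+ q) (x ^+ j) = 0 /\ F (y ^+ q) (y ^+ j) = 0).

(* The Hochschild 2-cocycle corresponding to the cocycle
   f(z) = (lam z x, - y z, 0, - z (sigma phi)'(z)) of the periodic complex;
   bilinearity is carried by the type of F. *)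
Definition is_F1 (F : {bilinear A -> A -> A}) : Prop :=
  [/\ cocycle2 F, cond_a F, cond_b F
    & [/\ F x z = - (x * z), F y z = y * z,
          F x y = - (z * horner_alg z (sigma phi)^`()) & F y x = 0]].

Definition values_n (n : nat) (F : A -> A -> A) : Prop :=
  [/\ F x z = 0, F y z = y * z,
      F x y = ((-1) ^+ n / (n`!)%:R) *:
                (z ^+ n * horner_alg z (sigma phi)^`(n))
    & F y x = 0].

Definition integrating_family (F1 : A -> A -> A)
    (F : nat -> {bilinear A -> A -> A}) : Prop :=
  integrates F1 F /\
  forall n : nat, (2 <= n)%N -> [/\ cond_a (F n), cond_b (F n) & values_n n (F n)].

Definition xq (q : int) : A := if 0 <= q then x ^+ `|q|%N else y ^+ `|q|%N.

(* The pair (p, q) indexes the basis element z^p x_q. *)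
Definition basis_elt (b : nat * int) : A := z ^+ b.1 * xq b.2.

Definition weight (b : nat * int) : nat := (b.1 + (size phi).-1.+1 * `|b.2|)%N.

Definition in_Gamma (n : nat) (a : A) : Prop :=
  exists2 s : seq (k * (nat * int)),
    all (fun t => (weight t.2 <= n)%N) s
    & a = \sum_(t <- s) t.1 *: basis_elt t.2.

Definition preserves_Gamma (F : A -> A -> A) : Prop :=
  forall b1 b2 : nat * int,
    in_Gamma (weight b1 + weight b2) (F (basis_elt b1) (basis_elt b2)).

End Defs.

(* Main.v *)
Require Import Defs.
From HB Require Import structures.
From mathcomp Require Import all_boot all_order all_algebra.
From mathcomp Require Import boolp finmap.
From mathcomp Require Import monalg.

(** The maps F_n are the Taylor coefficients of a deformation of the twisting
    parameter.  Over the power series ring k[[t]], put mu = lam (1 - t), and let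
    A_t be the algebra over k[[t]] with the same presentation as A, in which lam
    is replaced by mu.  The elements z^p x_q form a basis of both A and A_t, so
    the product of A_t is a k[[t]]-bilinear product on A[[t]], and the
    coefficients of a * b = a b + t F_1(a,b) + t^2 F_2(a,b) + ... satisfy the
    integration equations because A_t is associative.  The prescribed values are
    the relations of A_t: x z = lam (1 - t) z x only has terms of order 0 and 1,
    1 / (1 - t) gives F_n(y,z) = y z for all n, y x = phi(z) has no correction,
    and x y = phi(lam (1 - t) z) is expanded by Taylor's formula, where the
    characteristic enters through 1 / n!.

    Both algebras come from one construction.  Let D be a commutative ring with
    an automorphism sigma and an element phi.  On the free D-module with basis
    the symbols x_q, left multiplication by x and by y is given by semilinear
    operators satisfying y x = phi and x y = sigma phi.  The product of a and b
    is then the sum of the a_q times X_q(b), where X_q is the q-th power of the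
    operator of x, or of y when q < 0; its associativity [starA] reduces to those
    two operator identities.  With D = k[z] this is an algebra with basis
    z^p x_q, and the universal property identifies it with A
    ([gwa_presentation]).  With D = k[[t]][z] it is A_t, and the maps F_n are
    the [cochain n], for which associativity becomes [cochain_assoc].

    Uniqueness holds because, once F_1, ..., F_(n-1) are known, two candidates
    for F_n differ by a Hochschild cocycle that satisfies (a) and (b) and
    vanishes on (x,z), (y,z), (x,y) and (y,x).  The cocycle identity propagates
    this vanishing, first to the pairs of x or y with a basis element, then to
    all pairs ([normalized_cocycle_eq0]).  The same argument shows that the given
    F_1 is the first coefficient of the deformed product.

    The filtration is preserved because the operators of x and y already raise
    the weight by at most l + 1: a move away from q = 0 costs l + 1 and leaves
    the degree in z unchanged, a move towards q = 0 frees l + 1 and multiplies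
    by a polynomial of degree at most l. *)

Set Implicit Arguments.
Unset Strict Implicit.
Unset Printing Implicit Defensive.

Import GRing.Theory.
Local Open Scope ring_scope.

(** * Modules with a basis, and the skew product on D-combinations of the x_q *)

Section FreeModule.
Variables (D : comNzRingType) (K : choiceType).

Lemma malg_ind (P : {malg D[K]} -> Prop) :
  P 0 -> (forall a b, P a -> P b -> P (a + b)) ->
  (forall (c : D) q, P (c *: << 1 *g q >>)) -> forall a, P a.
Proof.
move=> P0 PD PU a; rewrite [a]monalgE; elim/big_rec: _ => // q b _ Pb.
apply: PD => //; suff -> : << a@_q *g q >> = a@_q *: << 1 *g q >> by [].
by apply/malgP => j; rewrite mcoeffZ !mcoeffU mulrnAr mulr1.
Qed.

Section Lift.
Variables (V : zmodType) (g : K -> {additive D -> V}).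

(** The universal property of a direct sum of copies of D, for additive maps.
    Only additivity is required of the components, so that the twisted and the
    untwisted extensions below are both instances. *)
Definition malg_lift (a : {malg D[K]}) : V := \sum_(q <- msupp a) g q a@_q.

Lemma malg_lift_wide (d : {fset K}) a : fsubset (msupp a) d ->
  malg_lift a = \sum_(q <- d) g q a@_q.
Proof.
move=> le_d; rewrite /malg_lift (big_fset_incl _ le_d) //= => q _ /mcoeff_outdom ->.
by rewrite raddf0.
Qed.

Lemma malg_lift_zmod_morphism : zmod_morphism malg_lift.
Proof.
move=> a b; rewrite (@malg_lift_wide (fsetU (msupp a) (msupp b)) a) ?fsubsetUl //.
rewrite (@malg_lift_wide (fsetU (msupp a) (msupp b)) b) ?fsubsetUr //.
rewrite (@malg_lift_wide (fsetU (msupp a) (msupp b))) ?msuppB_le //.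
by rewrite -sumrB; apply: eq_bigr => q _; rewrite mcoeffB raddfB.
Qed.
HB.instance Definition _ :=
  GRing.isZmodMorphism.Build {malg D[K]} V malg_lift malg_lift_zmod_morphism.

Lemma malg_liftU c q : malg_lift << c *g q >> = g q c.
Proof.
by rewrite (@malg_lift_wide (fset1 q)) ?msuppU_le // big_seq_fset1 mcoeffUU.
Qed.
End Lift.

Section Semilift.
Variables (E : comNzRingType) (V : lmodType E) (s : {additive D -> E}).

Definition scale_of (v : V) (d : D) : V := s d *: v.
Lemma scale_of_zmod_morphism v : zmod_morphism (scale_of v).
Proof. by move=> a b; rewrite /scale_of raddfB scalerBl. Qed.
HB.instance Definition _ v :=
  GRing.isZmodMorphism.Build D V (scale_of v) (scale_of_zmod_morphism v).

Variable h : K -> V.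
Definition semilift : {malg D[K]} -> V := malg_lift (fun q => scale_of (h q)).
HB.instance Definition _ := GRing.Additive.copy semilift (malg_lift (fun q => scale_of (h q))).

Lemma semilift0 : semilift 0 = 0. Proof. exact: raddf0. Qed.
Lemma semiliftD : {morph semilift : a b / a + b}. Proof. exact: raddfD. Qed.

Lemma semiliftU c q : semilift << c *g q >> = s c *: h q.
Proof. by rewrite /semilift malg_liftU. Qed.
End Semilift.
End FreeModule.


Section SkewModule.
Variables (D : comNzRingType) (sigma tau : {rmorphism D -> D}) (phi : D).
Hypotheses (sigmaK : cancel sigma tau) (tauK : cancel tau sigma).
Local Notation W := {malg D[int]}.
Local Notation xb q := (<< 1 *g q >> : W).

(** The product x x_q.  For q < 0 one factor y is consumed by the relation
    x y = sigma phi. *)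
Definition x_mul_basis (q : int) : W :=
  match q with
  | Posz n => (xb (Posz n.+1))
  | Negz 0 => sigma phi *: (xb (Posz 0))
  | Negz n.+1 => sigma phi *: (xb (Negz n))
  end.

(** The product y x_q.  For q > 0 one factor x is consumed by the relation
    y x = phi. *)
Definition y_mul_basis (q : int) : W :=
  match q with
  | Posz 0 => (xb (Negz 0))
  | Posz n.+1 => phi *: (xb (Posz n))
  | Negz n => (xb (Negz n.+1))
  end.

(** Left multiplication by x: it moves past a coefficient d in D by applying
    sigma to it. *)
Definition left_x : W -> W := semilift sigma x_mul_basis.
Definition left_y : W -> W := semilift tau y_mul_basis.
HB.instance Definition _ := GRing.Additive.copy left_x (semilift sigma x_mul_basis).
HB.instance Definition _ := GRing.Additive.copy left_y (semilift tau y_mul_basis).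
Lemma left_x0 : left_x 0 = 0. Proof. exact: raddf0. Qed.
Lemma left_xD : {morph left_x : a b / a + b}. Proof. exact: raddfD. Qed.
Lemma left_y0 : left_y 0 = 0. Proof. exact: raddf0. Qed.
Lemma left_yD : {morph left_y : a b / a + b}. Proof. exact: raddfD. Qed.

Lemma malgZU (c d : D) (q : int) : c *: (<< d *g q >> : W) = << c * d *g q >>.
Proof. by apply/malgP => j; rewrite mcoeffZ !mcoeffU mulrnAr. Qed.

Lemma semiliftZ (s : {rmorphism D -> D}) (h : int -> W) c a :
  semilift s h (c *: a) = s c *: semilift s h a.
Proof.
elim/malg_ind: a => [|a b IHa IHb|d q].
- by rewrite scaler0 semilift0 scaler0.
- by rewrite scalerDr !semiliftD IHa IHb scalerDr.
by rewrite !malgZU !semiliftU !mulr1 scalerA -rmorphM.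
Qed.

Lemma left_xZ c a : left_x (c *: a) = sigma c *: left_x a.
Proof. exact: semiliftZ. Qed.
Lemma left_yZ c a : left_y (c *: a) = tau c *: left_y a.
Proof. exact: semiliftZ. Qed.
Lemma left_x_basis q : left_x (xb q) = x_mul_basis q.
Proof. by rewrite /left_x semiliftU /= rmorph1 scale1r. Qed.
Lemma left_y_basis q : left_y (xb q) = y_mul_basis q.
Proof. by rewrite /left_y semiliftU /= rmorph1 scale1r. Qed.

Lemma left_yx a : left_y (left_x a) = phi *: a.
Proof.
elim/malg_ind: a => [|a b IHa IHb|d q].
- by rewrite !(left_x0, left_y0) scaler0.
- by rewrite !(left_xD, left_yD) IHa IHb scalerDr.
rewrite left_xZ left_x_basis left_yZ sigmaK [RHS]scalerA mulrC -scalerA; congr (_ *: _).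
case: q => [n|[|n]] /=; first by rewrite left_y_basis.
- by rewrite left_yZ left_y_basis sigmaK.
- by rewrite left_yZ left_y_basis sigmaK.
Qed.

Lemma left_xy a : left_x (left_y a) = sigma phi *: a.
Proof.
elim/malg_ind: a => [|a b IHa IHb|d q].
- by rewrite !(left_x0, left_y0) scaler0.
- by rewrite !(left_xD, left_yD) IHa IHb scalerDr.
rewrite left_yZ left_y_basis left_xZ tauK [RHS]scalerA mulrC -scalerA; congr (_ *: _).
by case: q => [[|n]|n] /=; rewrite ?left_xZ left_x_basis.
Qed.

(** Left multiplication by x_q. *)
Definition left_xq (q : int) : W -> W :=
  match q with
  | Posz n => iter n left_x
  | Negz n => iter n.+1 left_y
  end.

Lemma left_xq_zmod_morphism q : zmod_morphism (left_xq q).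
Proof.
have it (f : {additive W -> W}) n : zmod_morphism (iter n f).
  by move=> a b; elim: n => //= n ->; rewrite raddfB.
by case: q => n; apply: it.
Qed.
HB.instance Definition _ q := GRing.isZmodMorphism.Build W W (left_xq q) (left_xq_zmod_morphism q).

Definition star (a b : W) : W := semilift (idfun : {additive D -> D}) (left_xq ^~ b) a.

Lemma starDl a a' b : star (a + a') b = star a b + star a' b.
Proof. exact: raddfD. Qed.
Lemma star0l b : star 0 b = 0.
Proof. exact: raddf0. Qed.
Lemma star_basis q b : star (xb q) b = left_xq q b.
Proof. by rewrite /star semiliftU scale1r. Qed.
Lemma starZl c a b : star (c *: a) b = c *: star a b.
Proof. exact: (semiliftZ idfun). Qed.
Lemma starDr a b b' : star a (b + b') = star a b + star a b'.
Proof.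
rewrite /star /semilift /malg_lift -big_split; apply: eq_bigr => q _ /=.
by rewrite /scale_of raddfD scalerDr.
Qed.

(** Associativity when the first factor is x.  On basis elements it holds by
    definition for q >= 0, and by [left_xy] for q < 0. *)
Lemma star_left_x b c : star (left_x b) c = left_x (star b c).
Proof.
elim/malg_ind: b => [|a b IHa IHb|d q].
- by rewrite !(star0l, left_x0, left_y0).
- by rewrite !(left_xD, left_yD, starDl) IHa IHb.
rewrite left_xZ !starZl left_xZ left_x_basis star_basis; congr (_ *: _).
case: q => [n|[|n]] /=; first by rewrite star_basis.
- by rewrite starZl star_basis left_xy.
- by rewrite starZl star_basis left_xy.
Qed.

Lemma star_left_y b c : star (left_y b) c = left_y (star b c).
Proof.
elim/malg_ind: b => [|a b IHa IHb|d q].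
- by rewrite !(star0l, left_x0, left_y0).
- by rewrite !(left_xD, left_yD, starDl) IHa IHb.
rewrite left_yZ !starZl left_yZ left_y_basis star_basis; congr (_ *: _).
case: q => [[|n]|n] /=; rewrite ?star_basis //.
by rewrite starZl star_basis left_yx.
Qed.

Lemma star_left_xq q b c : star (left_xq q b) c = left_xq q (star b c).
Proof.
case: q => n /=; first by elim: n => //= n IH; rewrite star_left_x IH.
by elim: n => [|n /= IH]; rewrite /= star_left_y ?IH.
Qed.

(** Every first factor is a D-combination of the x_q, and x_q is a power of x
    or of y, so this follows from [star_left_x] and [star_left_y]. *)
Lemma starA : associative star.
Proof.
move=> a b c; elim/malg_ind: a => [|a a' IHa IHb|d q].
- by rewrite !star0l.
- by rewrite !starDl IHa IHb.
by rewrite !starZl !star_basis star_left_xq.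
Qed.

Lemma star1l : left_id (xb 0) star.
Proof. by move=> a; rewrite star_basis. Qed.

Lemma left_xq_unit q : left_xq q (xb 0) = (xb q).
Proof.
case: q => n /=; first by elim: n => //= n ->; rewrite left_x_basis.
by elim: n => [|n /= ->]; rewrite /= left_y_basis.
Qed.

Lemma star1r : right_id (xb 0) star.
Proof.
move=> a; elim/malg_ind: a => [|a a' IHa IHb|d q].
- by rewrite !star0l.
- by rewrite !starDl IHa IHb.
by rewrite starZl star_basis left_xq_unit.
Qed.

End SkewModule.

(** * Base change, and generalized Weyl algebras over R[z] *)

Section MalgMap.
Variables (D E : comNzRingType) (K : choiceType) (h : {additive D -> E}).

Definition malg_map : {malg D[K]} -> {malg E[K]} := semilift h (fun q => << 1 *g q >>).
HB.instance Definition _ := GRing.Additive.copy malg_map (semilift h (fun q => << 1 *g q >> : {malg E[K]})).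

Lemma malg_map0 : malg_map 0 = 0. Proof. exact: raddf0. Qed.
Lemma malg_mapD : {morph malg_map : a b / a + b}. Proof. exact: raddfD. Qed.

Lemma malg_mapU c q : malg_map (c *: << 1 *g q >>) = h c *: << 1 *g q >>.
Proof.
suff -> : c *: << 1 *g q >> = << c *g q >> by rewrite /malg_map semiliftU.
by apply/malgP => j; rewrite mcoeffZ !mcoeffU mulrnAr mulr1.
Qed.

Lemma mcoeff_malg_map a q : (malg_map a)@_q = h a@_q.
Proof.
elim/malg_ind: a => [|a b IHa IHb|d j].
- by rewrite malg_map0 !mcoeff0 raddf0.
- by rewrite malg_mapD !mcoeffD IHa IHb raddfD.
by rewrite malg_mapU !mcoeffZ !mcoeffU; case: (j == q); rewrite !(mulr1, mulr0, raddf0).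
Qed.
End MalgMap.

Section Functoriality.
Variables (D : comNzRingType) (sigma tau : {rmorphism D -> D}) (phi : D).
Variables (E : comNzRingType) (sigma' tau' : {rmorphism E -> E}) (phi' : E).
Variable h : {rmorphism D -> E}.
Hypotheses (h_sigma : forall d, h (sigma d) = sigma' (h d))
  (h_tau : forall d, h (tau d) = tau' (h d)) (h_phi : h phi = phi').
Local Notation hm := (malg_map (K := int) h).

Lemma malg_map_basis q : hm << 1 *g q >> = << 1 *g q >>.
Proof.
by have := malg_mapU h 1 q; rewrite !scale1r /= rmorph1 scale1r.
Qed.

Lemma malg_mapZ c a : hm (c *: a) = h c *: hm a.
Proof. by apply/malgP => q; rewrite mcoeff_malg_map !mcoeffZ mcoeff_malg_map /= rmorphM. Qed.

Lemma malg_map_left_x a : hm (left_x sigma phi a) = left_x sigma' phi' (hm a).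
Proof.
elim/malg_ind: a => [|a b IHa IHb|d q].
- by rewrite !(left_x0, malg_map0).
- by rewrite !(left_xD, malg_mapD) IHa IHb.
rewrite left_xZ !malg_mapZ left_xZ h_sigma; congr (_ *: _).
rewrite malg_map_basis !left_x_basis.
by case: q => [n|[|n]] /=; rewrite ?malg_mapZ malg_map_basis ?h_sigma ?h_phi.
Qed.

Lemma malg_map_left_y a : hm (left_y tau phi a) = left_y tau' phi' (hm a).
Proof.
elim/malg_ind: a => [|a b IHa IHb|d q].
- by rewrite !(left_y0, malg_map0).
- by rewrite !(left_yD, malg_mapD) IHa IHb.
rewrite left_yZ !malg_mapZ left_yZ h_tau; congr (_ *: _).
rewrite malg_map_basis !left_y_basis.
by case: q => [[|n]|n] /=; rewrite ?malg_mapZ malg_map_basis ?h_phi.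
Qed.

(** The product is functorial in (D, sigma, tau, phi).  This is what identifies
    the deformed product at t = 0 with the original one. *)
Lemma malg_map_star a b :
  hm (star sigma tau phi a b) = star sigma' tau' phi' (hm a) (hm b).
Proof.
elim/malg_ind: a => [|a a' IHa IHb|d q].
- by rewrite malg_map0 !star0l malg_map0.
- by rewrite malg_mapD !starDl malg_mapD IHa IHb.
rewrite starZl !malg_mapZ starZl malg_map_basis !star_basis; congr (_ *: _).
case: q => n /=; first by elim: n => //= n IH; rewrite malg_map_left_x IH.
by elim: n => [|n /= IH]; rewrite malg_map_left_y ?IH.
Qed.
End Functoriality.

Section ModelAlgebra.
Variables (R : comNzRingType) (mu nu : R).

(** The automorphism z |-> c z. *)
Definition dilate (c : R) : {rmorphism {poly R} -> {poly R}} := comp_poly (c *: 'X).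

Lemma dilateE c p : dilate c p = p \Po (c *: 'X). Proof. by []. Qed.

Lemma coef_dilate c p i : (dilate c p)`_i = c ^+ i * p`_i.
Proof.
rewrite dilateE coef_comp_poly.
under eq_bigr => j _ do rewrite exprZn coefZ coefXn.
have [lt_i|ge_i] := ltnP i (size p).
  rewrite (bigD1 (Ordinal lt_i)) //= eqxx mulr1 mulrC big1 ?addr0 // => j ne_j.
  by rewrite eq_sym (negbTE (ne_j : j != i :> nat)) !mulr0.
rewrite big1 => [|j _]; first by rewrite nth_default ?mulr0.
by rewrite eq_sym ltn_eqF ?mulr0 // (leq_trans _ ge_i).
Qed.

Lemma dilateC c d : dilate c d%:P = d%:P. Proof. exact: comp_polyC. Qed.
Lemma dilateX c : dilate c 'X = c *: 'X. Proof. exact: comp_polyX. Qed.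

Lemma dilate_MXaddC c p d :
  dilate c (p * 'X + d%:P) = c *: (dilate c p * 'X) + d%:P.
Proof. by rewrite dilateE comp_polyD comp_polyM comp_polyX comp_polyC -scalerAr. Qed.

Hypothesis mu_nu : mu * nu = 1.

Lemma dilateK : cancel (dilate mu) (dilate nu).
Proof.
move=> p; apply/polyP => i; by rewrite !coef_dilate mulrA -exprMn [nu * _]mulrC mu_nu expr1n mul1r.
Qed.
Lemma dilateVK : cancel (dilate nu) (dilate mu).
Proof.
by move=> p; apply/polyP => i; rewrite !coef_dilate mulrA -exprMn mu_nu expr1n mul1r.
Qed.

Variable phi : {poly R}.

(** The proof that mu is invertible is an argument of the type, so that the ring
    structure, whose associativity depends on it, can be inferred. *)
Definition gwa of mu * nu = 1 & {poly R} := {malg {poly R}[int]}.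
Local Notation B := (gwa mu_nu phi).
HB.instance Definition _ := GRing.Zmodule.on B.

Definition gwa_mul : B -> B -> B := star (dilate mu) (dilate nu) phi.
Definition gwa_one : B := << 1 *g Posz 0 >>.

Lemma gwa_mulA : associative gwa_mul.
Proof. exact: starA dilateK dilateVK. Qed.
Lemma gwa_mul1l : left_id gwa_one gwa_mul. Proof. exact: star1l. Qed.
Lemma gwa_mul1r : right_id gwa_one gwa_mul. Proof. exact: star1r. Qed.
Lemma gwa_mulDl : left_distributive gwa_mul +%R.
Proof. by move=> a b c; apply: starDl. Qed.
Lemma gwa_mulDr : right_distributive gwa_mul +%R.
Proof. by move=> a b c; apply: starDr. Qed.
Lemma gwa_one_neq0 : gwa_one != 0.
Proof.
by apply/eqP => /(congr1 (mcoeff (Posz 0))); rewrite mcoeffUU mcoeff0; apply/eqP/oner_neq0.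
Qed.
HB.instance Definition _ := GRing.Zmodule_isNzRing.Build B
  gwa_mulA gwa_mul1l gwa_mul1r gwa_mulDl gwa_mulDr gwa_one_neq0.

(** The underlying module carries an action of R[z]; the algebra structure
    only uses the constants, since z is not central. *)
Definition gwa_scale (c : R) (a : B) : B := (c%:P *: (a : {malg {poly R}[int]})).
Lemma gwa_scaleA b c a : gwa_scale b (gwa_scale c a) = gwa_scale (b * c) a.
Proof. by rewrite /gwa_scale scalerA polyCM. Qed.
Lemma gwa_scale1 : left_id 1 gwa_scale.
Proof. by move=> a; rewrite /gwa_scale scale1r. Qed.
Lemma gwa_scaleDr : right_distributive gwa_scale +%R.
Proof. by move=> c a b; rewrite /gwa_scale scalerDr. Qed.
Lemma gwa_scaleDl a : {morph gwa_scale^~ a : b c / b + c}.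
Proof. by move=> b c; rewrite /gwa_scale polyCD scalerDl. Qed.
HB.instance Definition _ := GRing.Zmodule_isLmodule.Build R B
  gwa_scaleA gwa_scale1 gwa_scaleDr gwa_scaleDl.

Lemma gwa_scalerAl (c : R) (a b : B) : c *: (a * b) = c *: a * b.
Proof. by rewrite -[RHS]/(gwa_mul _ _) /gwa_mul starZl. Qed.
HB.instance Definition _ := GRing.Lmodule_isLalgebra.Build R B gwa_scalerAl.

Lemma left_xqZ_const c (a : B) q :
  left_xq (dilate mu) (dilate nu) phi q (c%:P *: (a : {malg _[_]}))
  = c%:P *: left_xq (dilate mu) (dilate nu) phi q a.
Proof.
case: q => n /=; first by elim: n => //= n ->; rewrite left_xZ dilateC.
by elim: n => [|n /= ->]; rewrite /= left_yZ dilateC.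
Qed.

Lemma gwa_scalerAr (c : R) (a b : B) : c *: (a * b) = a * (c *: b).
Proof.
rewrite -[LHS]/(c%:P *: star _ _ _ a b) -[RHS]/(star _ _ _ a (c%:P *: _)).
elim/malg_ind: a => [|a a' IHa IHb|d q].
- by rewrite !star0l scaler0.
- by rewrite !starDl scalerDr IHa IHb.
by rewrite !starZl !star_basis left_xqZ_const !scalerA mulrC.
Qed.
HB.instance Definition _ := GRing.Lalgebra_isAlgebra.Build R B gwa_scalerAr.
End ModelAlgebra.

(** * The explicit algebra is the one presented by generators and relations *)

Section ModelGenerators.
Variables (R : comNzRingType) (mu nu : R) (mu_nu : mu * nu = 1) (phi : {poly R}).
Local Notation B := (gwa mu_nu phi).
Local Notation W := {malg {poly R}[int]}.

Definition gwa_xpow (q : int) : B := << 1 *g q >>.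
Definition gwa_poly (p : {poly R}) : B := p *: (gwa_xpow 0 : W).
Definition gwa_x : B := gwa_xpow (Posz 1).
Definition gwa_y : B := gwa_xpow (Negz 0).
Definition gwa_z : B := gwa_poly 'X.

Lemma gwa_mulE (a b : B) : a * b = star (dilate mu) (dilate nu) phi a b.
Proof. by []. Qed.
Lemma gwa_scaleE (c : R) (a : B) : c *: a = c%:P *: (a : W).
Proof. by []. Qed.

Lemma gwa_mulZl p (a b : B) : (p *: (a : W) : B) * b = p *: (a * b : W).
Proof. by rewrite !gwa_mulE starZl. Qed.
Lemma gwa_poly_mul p (a : B) : gwa_poly p * a = p *: (a : W).
Proof. by rewrite gwa_mulE starZl star_basis. Qed.
Lemma gwa_x_mul (a : B) : gwa_x * a = left_x (dilate mu) phi a.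
Proof. by rewrite gwa_mulE star_basis. Qed.
Lemma gwa_y_mul (a : B) : gwa_y * a = left_y (dilate nu) phi a.
Proof. by rewrite gwa_mulE star_basis. Qed.

Lemma horner_gwa p : horner_alg gwa_z p = gwa_poly p.
Proof.
elim/poly_ind: p => [|p c IH]; first by rewrite raddf0 /gwa_poly scale0r.
rewrite rmorphD rmorphM /= horner_algX horner_algC IH gwa_poly_mul /gwa_poly /gwa_z.
by rewrite /gwa_poly gwa_scaleE scalerDl scalerA.
Qed.

Lemma gwa_x_exp n : gwa_x ^+ n = gwa_xpow (Posz n).
Proof. by elim: n => // n IH; rewrite exprS IH gwa_x_mul left_x_basis. Qed.
Lemma gwa_y_exp n : gwa_y ^+ n.+1 = gwa_xpow (Negz n).
Proof. by elim: n => [|n IH]; rewrite ?expr1 // exprS IH gwa_y_mul left_y_basis. Qed.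

Lemma gwa_x_poly p : gwa_x * gwa_poly p = gwa_poly (dilate mu p) * gwa_x.
Proof. by rewrite gwa_x_mul gwa_poly_mul left_xZ left_x_basis. Qed.
Lemma gwa_y_poly p : gwa_y * gwa_poly p = gwa_poly (dilate nu p) * gwa_y.
Proof. by rewrite gwa_y_mul gwa_poly_mul left_yZ left_y_basis. Qed.

Lemma gwa_polyZ c p : gwa_poly (c *: p) = c *: gwa_poly p.
Proof. by rewrite /gwa_poly gwa_scaleE scalerA mul_polyC. Qed.

Lemma gwa_polyM p q : gwa_poly (p * q) = gwa_poly p * gwa_poly q.
Proof. by rewrite gwa_poly_mul /gwa_poly scalerA. Qed.
Lemma gwa_z_exp n : gwa_z ^+ n = gwa_poly 'X^n.
Proof. by rewrite -horner_gwa rmorphXn /= horner_algX. Qed.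

Lemma gwa_xz : gwa_x * gwa_z = mu *: (gwa_z * gwa_x).
Proof. by rewrite gwa_x_poly dilateX gwa_polyZ scalerAl. Qed.
Lemma gwa_yz : gwa_y * gwa_z = nu *: (gwa_z * gwa_y).
Proof. by rewrite gwa_y_poly dilateX gwa_polyZ scalerAl. Qed.
Lemma gwa_yx : gwa_y * gwa_x = gwa_poly phi.
Proof. by rewrite gwa_y_mul left_y_basis. Qed.
Lemma gwa_xy : gwa_x * gwa_y = gwa_poly (dilate mu phi).
Proof. by rewrite gwa_x_mul left_x_basis. Qed.
End ModelGenerators.

(** An element that commutes with z up to the scalar c moves past p(z) by
    turning it into p(c z). *)
Lemma twist_horner (R : comNzRingType) (A : algType R) (w z : A) (c : R) p :
  w * z = c *: (z * w) -> w * horner_alg z p = horner_alg z (dilate c p) * w.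
Proof.
move=> wz; elim/poly_ind: p => [|p d IH]; first by rewrite !raddf0 mulr0 mul0r.
have hE q : horner_alg z (q + d%:P) = horner_alg z q + d%:A.
  by rewrite rmorphD /= horner_algC.
rewrite dilate_MXaddC.
rewrite !hE mulrDr mulrDl linearZ !rmorphM /= horner_algX [w * (_ * z)]mulrA IH dilateE -!mulrA wz.
by rewrite -!(scalerAl, scalerAr) mulr1 !mul1r. 
Qed.

Section Presentation.
Variables (k : fieldType) (lam : k) (lam_unit : lam * lam^-1 = 1) (phi : {poly k}).
Local Notation B := (gwa lam_unit phi).

Lemma gwa_model_relations :
  gwa_relations lam phi (gwa_x lam_unit phi) (gwa_y lam_unit phi) (gwa_z lam_unit phi).
Proof. by split; rewrite ?horner_gwa; [exact: gwa_xz|exact: gwa_yz|exact: gwa_yx|exact: gwa_xy]. Qed.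

Lemma gwa_xq q :
  xq (gwa_x lam_unit phi) (gwa_y lam_unit phi) q = gwa_xpow lam_unit phi q.
Proof. by case: q => n; rewrite /xq /= ?gwa_x_exp ?gwa_y_exp. Qed.

Section Realize.
Variables (A : algType k) (x y z : A).

Definition realize_term (q : int) (p : {poly k}) : A := horner_alg z p * xq x y q.
Lemma realize_term_zmod_morphism q : zmod_morphism (realize_term q).
Proof. by move=> a b; rewrite /realize_term raddfB mulrBl. Qed.
HB.instance Definition _ q :=
  GRing.isZmodMorphism.Build {poly k} A (realize_term q) (realize_term_zmod_morphism q).

(** The evaluation of the explicit algebra at elements x, y, z of any algebra. *)
Definition realize : B -> A := malg_lift realize_term.
HB.instance Definition _ := GRing.Additive.copy realize (malg_lift realize_term).

Lemma realize_xpow q : realize (gwa_xpow lam_unit phi q) = xq x y q.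
Proof. by rewrite /realize malg_liftU /= /realize_term rmorph1 mul1r. Qed.

Lemma realizeU p q : realize (p *: (gwa_xpow lam_unit phi q : {malg _[_]})) = horner_alg z p * xq x y q.
Proof. by rewrite malgZU mulr1 /realize malg_liftU. Qed.

Lemma realizeZp p a : realize (p *: (a : {malg _[_]})) = horner_alg z p * realize a.
Proof.
elim/malg_ind: a => [|a b IHa IHb|d q].
- by rewrite scaler0 raddf0 mulr0.
- by rewrite scalerDr raddfD /= IHa IHb raddfD mulrDr.
by rewrite scalerA !realizeU rmorphM mulrA.
Qed.

Hypothesis rel : gwa_relations lam phi x y z.

Lemma rel_x_horner p : x * horner_alg z p = horner_alg z (dilate lam p) * x.
Proof. by case: rel => xz _ _ _; apply: twist_horner. Qed.

Lemma rel_y_horner p : y * horner_alg z p = horner_alg z (dilate lam^-1 p) * y.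
Proof. by case: rel => _ yz _ _; apply: twist_horner. Qed.

Lemma realize_left_x a : realize (left_x (dilate lam) phi a) = x * realize a.
Proof.
have [_ _ _ xy] := rel.
elim/malg_ind: a => [|a b IHa IHb|d q].
- by rewrite left_x0 raddf0 mulr0.
- by rewrite left_xD !raddfD /= IHa IHb mulrDr.
rewrite left_xZ !realizeZp realize_xpow mulrA rel_x_horner -mulrA; congr (_ * _).
rewrite left_x_basis.
case: q => [n|[|n]]; rewrite /= ?realizeZp ?realize_xpow /xq /=.
- by rewrite exprS.
- by rewrite expr1 mulr1 xy.
- by rewrite [in RHS]exprS mulrA xy.
Qed.

Lemma realize_left_y a : realize (left_y (dilate lam^-1) phi a) = y * realize a.
Proof.
have [_ _ yx _] := rel.
elim/malg_ind: a => [|a b IHa IHb|d q].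
- by rewrite left_y0 raddf0 mulr0.
- by rewrite left_yD !raddfD /= IHa IHb mulrDr.
rewrite left_yZ !realizeZp realize_xpow mulrA rel_y_horner -mulrA; congr (_ * _).
rewrite left_y_basis.
case: q => [[|n]|n]; rewrite /= ?realizeZp ?realize_xpow /xq /=.
- by rewrite mulr1.
- by rewrite [in RHS]exprS mulrA yx.
- by rewrite !exprS.
Qed.

(** [realize] intertwines the operators of x and y with multiplication by x and
    y because the relations hold, and these operators generate all the left
    multiplications. *)
Lemma realizeM : {morph realize : a b / a * b}.
Proof.
move=> a b; rewrite gwa_mulE; elim/malg_ind: a => [|a a' IHa IHb|d q].
- by rewrite star0l raddf0 mul0r.
- by rewrite starDl !raddfD /= IHa IHb mulrDl.
rewrite starZl !realizeZp -mulrA star_basis; congr (_ * _).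
rewrite realize_xpow.
case: q => n; rewrite /xq /=.
  by elim: n => [|n IH]; rewrite /= ?mul1r // realize_left_x IH mulrA exprS.
elim: n => [|n IH] /=; first by rewrite realize_left_y expr1.
by rewrite realize_left_y IH mulrA -exprS.
Qed.

Lemma realize1 : realize 1 = 1.
Proof. exact: realize_xpow. Qed.

Lemma realize_scalable : scalable realize.
Proof. by move=> c a; rewrite gwa_scaleE realizeZp horner_algC -scalerAl mul1r. Qed.

Lemma realize_lrmorphism : exists g : {lrmorphism B -> A}, g =1 realize.
Proof.
pose mM := GRing.isMonoidMorphism.Build B A realize (conj realize1 realizeM).
pose mS := GRing.isScalable.Build k B A *:%R realize realize_scalable.
pose g : {lrmorphism B -> A} := HB.pack realize mM mS.
by exists g.
Qed.
End Realize.

(** The universal property gives rho.  Then [realize] after rho is an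
    endomorphism of A that fixes the generators, hence the identity; the other
    composite is computed on the basis.  This is the basis theorem for A. *)
Lemma gwa_presentation (A : algType k) (x y z : A) : is_gwa lam phi x y z ->
  exists rho : {lrmorphism A -> B},
    [/\ rho x = gwa_x _ _, rho y = gwa_y _ _, rho z = gwa_z _ _,
        cancel rho (realize x y z) & cancel (realize x y z) rho].
Proof.
case=> rel univ; have [rho [[rx ry rz] _]] := univ _ _ _ _ gwa_model_relations.
exists rho; split=> // [a|b].
  (* f is the unique endomorphism of A that fixes x, y and z. *)
  have [f [_ uniq_f]] := univ _ _ _ _ rel.
  have [g gE] := realize_lrmorphism rel.
  have -> : realize x y z (rho a) = f a.
    rewrite -gE -[LHS]/((g \o rho) a); apply: uniq_f; rewrite /= rx ry rz !gE.
    by rewrite realizeU !realize_xpow /xq /= horner_algX mulr1.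
  exact/esym/(uniq_f (idfun : {lrmorphism A -> A})).
elim/malg_ind: b => [|a b IHa IHb|d q].
- by rewrite !raddf0.
- by rewrite !raddfD /= IHa IHb.
rewrite realizeU rmorphM /=.
have -> : rho (xq x y q) = gwa_xpow _ _ q.
  by rewrite -gwa_xq /xq; case: ifP; rewrite rmorphXn /= (rx, ry).
have -> : rho (horner_alg z d) = gwa_poly _ _ d.
  rewrite -horner_gwa -rz; elim/poly_ind: d => [|p c IH]; first by rewrite !raddf0.
  by rewrite !rmorphD !rmorphM /= !horner_algX !horner_algC IH linearZ /= rmorph1.
by rewrite gwa_poly_mul.
Qed.
End Presentation.

(** * Formal power series in the deformation parameter *)

Section PowerSeries.
Variable R : comNzRingType.

Definition pseries := nat -> R.
HB.instance Definition _ := Choice.copy pseries (nat -> R).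
Implicit Types f g h : pseries.

Lemma pseriesP f g : (forall n, f n = g n) -> f = g.
Proof. exact: funext. Qed.

Definition ps_add f g : pseries := fun n => f n + g n.
Definition ps_opp f : pseries := fun n => - f n.
Definition ps_zero : pseries := fun=> 0.
Definition ps_mul f g : pseries := fun n => \sum_(i < n.+1) f i * g (n - i)%N.
Definition pconst (c : R) : pseries := fun n => if n is 0 then c else 0.

Lemma ps_addA : associative ps_add.
Proof. by move=> f g h; apply: pseriesP => n; apply: addrA. Qed.
Lemma ps_addC : commutative ps_add.
Proof. by move=> f g; apply: pseriesP => n; apply: addrC. Qed.
Lemma ps_add0 : left_id ps_zero ps_add.
Proof. by move=> f; apply: pseriesP => n; apply: add0r. Qed.
Lemma ps_addN : left_inverse ps_zero ps_opp ps_add.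
Proof. by move=> f; apply: pseriesP => n; apply: addNr. Qed.
HB.instance Definition _ :=
  GRing.isZmodule.Build pseries ps_addA ps_addC ps_add0 ps_addN.

Definition truncate n f : {poly R} := \poly_(i < n.+1) f i.

Lemma coef_truncate n f i : (i <= n)%N -> (truncate n f)`_i = f i.
Proof. by rewrite coef_poly ltnS => ->. Qed.

Lemma coef_truncateM n f g i :
  (i <= n)%N -> (truncate n f * truncate n g)`_i = ps_mul f g i.
Proof.
move=> le_in; rewrite coefM; apply: eq_bigr => j _.
have le_ji : (j <= i)%N by rewrite -ltnS.
by rewrite !coef_truncate ?(leq_trans _ le_in) ?leq_subr.
Qed.

Lemma ps_mulC : commutative ps_mul.
Proof.
by move=> f g; apply: pseriesP => n; rewrite -!(@coef_truncateM n) // mulrC.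
Qed.

(** Each coefficient of a product only depends on truncations of the factors,
    so the identity holds because it holds for polynomials. *)
Lemma ps_mulA : associative ps_mul.
Proof.
move=> f g h; apply: pseriesP => n.
transitivity (truncate n f * (truncate n g * truncate n h))`_n.
  rewrite coefM; apply: eq_bigr => i _.
  by rewrite coef_truncate ?coef_truncateM ?leq_subr // -ltnS.
rewrite mulrA coefM; apply: eq_bigr => i _.
by rewrite coef_truncate ?coef_truncateM ?leq_subr // -ltnS.
Qed.

Lemma ps_const_mulE c f n : ps_mul (pconst c) f n = c * f n.
Proof.
rewrite /ps_mul big_ord_recl subn0 big1 ?addr0 // => i _.
by rewrite mul0r.
Qed.

Lemma ps_mul1 : left_id (pconst 1) ps_mul.
Proof. by move=> f; apply: pseriesP => n; rewrite ps_const_mulE mul1r. Qed.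

Lemma ps_mulDl : left_distributive ps_mul +%R.
Proof.
move=> f g h; apply: pseriesP => n; rewrite -[RHS]big_split.
by apply: eq_bigr => i _; apply: mulrDl.
Qed.

Lemma pconst1_neq0 : pconst 1 != 0.
Proof. by apply/eqP => /(congr1 (@^~ 0%N)) /eqP; apply/negP/oner_neq0. Qed.

HB.instance Definition _ := GRing.Zmodule_isComNzRing.Build pseries
  ps_mulA ps_mulC ps_mul1 ps_mulDl pconst1_neq0.

Definition pcoef n f : R := f n.
Lemma pcoef_zmod_morphism n : zmod_morphism (pcoef n). Proof. by []. Qed.
HB.instance Definition _ n :=
  GRing.isZmodMorphism.Build pseries R (pcoef n) (pcoef_zmod_morphism n).

Lemma pcoefM n f g : pcoef n (f * g) = \sum_(i < n.+1) pcoef i f * pcoef (n - i) g.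
Proof. by []. Qed.
Lemma pcoef_constM n c f : pcoef n (pconst c * f) = c * pcoef n f.
Proof. exact: ps_const_mulE. Qed.

Lemma pcoef0_monoid_morphism : monoid_morphism (pcoef 0).
Proof. by split=> // f g; rewrite pcoefM big_ord1. Qed.
HB.instance Definition _ :=
  GRing.isMonoidMorphism.Build pseries R (pcoef 0) pcoef0_monoid_morphism.

Lemma pconst_zmod_morphism : zmod_morphism pconst.
Proof. by move=> a b; apply: pseriesP => -[|n] //; apply/esym/subrr. Qed.
HB.instance Definition _ :=
  GRing.isZmodMorphism.Build R pseries pconst pconst_zmod_morphism.
Lemma pconst_monoid_morphism : monoid_morphism pconst.
Proof.
split=> // a b; apply: pseriesP => n; rewrite -[RHS]/(pcoef n _) pcoef_constM.
by case: n => //= n; rewrite /pcoef mulr0.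
Qed.
HB.instance Definition _ :=
  GRing.isMonoidMorphism.Build R pseries pconst pconst_monoid_morphism.

Definition pvar : pseries := fun n => (n == 1%N)%:R.
Definition pshift f : pseries := fun n => f n.+1.
Lemma pshift_zmod_morphism : zmod_morphism pshift. Proof. by []. Qed.
HB.instance Definition _ :=
  GRing.isZmodMorphism.Build pseries pseries pshift pshift_zmod_morphism.

Lemma pcoef_varM n f : pcoef n (pvar * f) = if n is m.+1 then pcoef m f else 0.
Proof.
rewrite pcoefM big_ord_recl mul0r add0r; case: n => [|n]; first by rewrite big_ord0.
rewrite big_ord_recl /= mul1r subn1 big1 ?addr0 // => i _.
by rewrite mul0r.
Qed.

(** Peeling off the constant term is the step of the inductions on the order
    in t, which replace any notion of convergence. *)
Lemma pseries_decomp f : f = pconst (pcoef 0 f) + pvar * pshift f.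
Proof.
apply: pseriesP => n; rewrite -[RHS]/(pcoef n _) raddfD /= pcoef_varM.
by case: n => [|n]; rewrite /pcoef /= ?addr0 ?add0r.
Qed.

Lemma pcoef_geometric n i :
  pcoef n ((1 - pvar) ^+ i) = (-1) ^+ n * 'C(i, n)%:R.
Proof.
elim: i n => [|i IH] n.
  by rewrite expr0 bin0n; case: n => [|n]; rewrite ?mulr0 ?mulr1.
case: n => [|n].
  by rewrite exprS mulrBl mul1r raddfB /= pcoef_varM subr0 IH !bin0.
rewrite exprS mulrBl mul1r raddfB /= pcoef_varM !IH binS natrD mulrDr; congr (_ + _).
by rewrite exprS mulN1r mulNr.
Qed.

End PowerSeries.

(** * The deformed product and its coefficients *)

(** Dilations are compatible with changing the coefficient ring, as the
    functoriality of the product requires. *)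
Lemma map_dilate (R S : comNzRingType) (h : {rmorphism R -> S}) c p :
  map_poly h (dilate c p) = dilate (h c) (map_poly h p).
Proof.
by apply/polyP => i; rewrite coef_map /= !coef_dilate coef_map /= rmorphM rmorphXn.
Qed.

Section Deformation.
Variables (k : fieldType) (lam : k) (lam_unit : lam * lam^-1 = 1) (phi : {poly k}).
Local Notation T := (pseries k).

(** The deformed parameter lam (1 - t). *)
Definition mu_t : T := pconst lam * (1 - pvar k).
(** The inverse of [mu_t]: lam^-1 times the geometric series. *)
Definition nu_t : T := fun=> lam^-1.

Lemma mu_nu_t : mu_t * nu_t = 1.
Proof.
apply: pseriesP => n; rewrite -[LHS]/(pcoef n _) /mu_t -mulrA pcoef_constM.
rewrite mulrBl mul1r raddfB /= pcoef_varM.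
by case: n => [|n]; rewrite /pcoef /nu_t ?subr0 // subrr mulr0.
Qed.

Lemma pcoef_mu n : pcoef n mu_t = lam * (if n is m.+1 then (if m is 0 then -1 else 0) else 1).
Proof.
rewrite /mu_t pcoef_constM -[1 - _]expr1 pcoef_geometric; congr (_ * _).
by case: n => [|[|n]]; rewrite ?expr1 ?mulr1 ?bin_small ?mulr0.
Qed.

Local Notation B := (gwa lam_unit phi).
Local Notation BT := (gwa mu_nu_t (map_poly (@pconst k) phi)).
Local Notation e_ := (gwa_xpow lam_unit phi).
Local Notation et_ := (gwa_xpow mu_nu_t (map_poly (@pconst k) phi)).
Local Notation W := {malg {poly k}[int]}.
Local Notation WT := {malg {poly T}[int]}.

(** An element of A as an element of A[[t]] that is constant in t. *)
Definition embed : B -> BT := malg_map (map_poly (@pconst k)).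
(** The coefficient of t^n in the basis z^p x_q. *)
Definition coeft (n : nat) : BT -> B := malg_map (map_poly (@pcoef k n)).
Definition shiftt : BT -> BT := malg_map (map_poly (@pshift k)).
HB.instance Definition _ := GRing.Additive.copy embed (malg_map (K := int) (map_poly (@pconst k))).
HB.instance Definition _ n := GRing.Additive.copy (coeft n) (malg_map (K := int) (map_poly (@pcoef k n))).

Lemma embed_polyM p a : embed (p *: (a : W)) = map_poly (@pconst k) p *: (embed a : WT).
Proof. exact: malg_mapZ. Qed.
Lemma embedZ c a : embed (c *: a) = pconst c *: embed a.
Proof. by rewrite !gwa_scaleE embed_polyM map_polyC. Qed.
Lemma embed_xpow q : embed (e_ q) = et_ q.
Proof. exact: malg_map_basis. Qed.

Lemma coeft_polyM n p a :
  coeft n (map_poly (@pconst k) p *: (a : WT)) = p *: (coeft n a : W).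
Proof.
apply/malgP => q; rewrite /coeft mcoeff_malg_map !mcoeffZ mcoeff_malg_map.
apply/polyP => i; rewrite /= coef_map /= !coefM raddf_sum; apply: eq_bigr => j _.
by rewrite !coef_map /= pcoef_constM.
Qed.
Lemma coeftZ n c a : coeft n (pconst c *: a) = c *: coeft n a.
Proof. by rewrite !gwa_scaleE -coeft_polyM map_polyC. Qed.

Lemma coeft_Zembed n r a : coeft n (r *: embed a) = pcoef n r *: a.
Proof.
apply/malgP => q; rewrite !gwa_scaleE /coeft /embed mcoeff_malg_map !mcoeffZ mcoeff_malg_map.
apply/polyP => i; rewrite /= coef_map /= !coefCM coef_map /= mulrC pcoef_constM mulrC //.
Qed.

Lemma coeft_embed n a : coeft n (embed a) = if n is 0 then a else 0.
Proof.
rewrite -[embed a]scale1r coeft_Zembed.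
by case: n => [|n]; rewrite ?scale1r ?scale0r.
Qed.

Lemma coeft_var n a : coeft n (pvar k *: a) = if n is m.+1 then coeft m a else 0.
Proof.
apply/malgP => q; rewrite !gwa_scaleE /coeft mcoeff_malg_map !mcoeffZ.
apply/polyP => i; rewrite /= coef_map /= coefCM pcoef_varM.
by case: n => [|n]; rewrite ?mcoeff_malg_map /= ?coef_map // mcoeff0 coef0.
Qed.

Lemma coeft_shift n a : coeft n (shiftt a) = coeft n.+1 a.
Proof.
apply/malgP => q; rewrite /coeft /shiftt !mcoeff_malg_map.
by apply/polyP => i; rewrite /= !coef_map.
Qed.

Lemma coeft_decomp a : a = embed (coeft 0 a) + pvar k *: shiftt a.
Proof.
apply/malgP => q; rewrite gwa_scaleE /coeft /shiftt /embed mcoeffD mcoeffZ !mcoeff_malg_map.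
apply/polyP => i; rewrite /= coefD coefCM !coef_map; exact: pseries_decomp.
Qed.

(** Reduction modulo t sends mu to lam, so it is a morphism by functoriality. *)
Lemma coeft0M a b : coeft 0 (a * b) = coeft 0 a * coeft 0 b.
Proof.
pose h : {rmorphism {poly T} -> {poly k}} := map_poly (@pcoef k 0).
apply: (@malg_map_star _ _ _ _ _ _ _ _ h) => [d|d|] /=.
- by rewrite map_dilate /= pcoef_mu mulr1.
- by rewrite map_dilate.
by apply/polyP => i; rewrite !coef_map.
Qed.

(** The coefficient of t^n in the deformed product of two elements of A. *)
Definition cochain (n : nat) (a b : B) : B := coeft n (embed a * embed b).

Lemma cochain0 a b : cochain 0 a b = a * b.
Proof. by rewrite /cochain coeft0M !coeft_embed. Qed.

Lemma cochain_bilinear n :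
  bilinear_for (GRing.Scale.Law.clone _ _ *:%R _) (GRing.Scale.Law.clone _ _ *:%R _) (cochain n).
Proof.
split=> u c a b; rewrite /cochain raddfD /= embedZ.
  by rewrite mulrDl -scalerAl raddfD /= coeftZ.
by rewrite mulrDr -scalerAr raddfD /= coeftZ.
Qed.

(** The deformed product is k[[t]]-linear in its first argument, so it can be
    expanded along the powers of t in that argument. *)
Lemma coeft_mul_embed n w c :
  coeft n (w * embed c) = \sum_(j < n.+1) cochain (n - j) (coeft j w) c.
Proof.
elim: n w => [|n IH] w.
  by rewrite big_ord1 subn0 cochain0 coeft0M coeft_embed.
rewrite big_ord_recl subn0 {1}[w]coeft_decomp mulrDl -scalerAl raddfD /= coeft_var IH -/(cochain _ _ _).
by apply: congr1; apply: eq_bigr => j _; rewrite coeft_shift /bump add1n subSS.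
Qed.

Lemma coeft_embed_mul n a w :
  coeft n (embed a * w) = \sum_(j < n.+1) cochain (n - j) a (coeft j w).
Proof.
elim: n w => [|n IH] w.
  by rewrite big_ord1 subn0 cochain0 coeft0M coeft_embed.
rewrite big_ord_recl subn0 {1}[w]coeft_decomp mulrDr -scalerAr raddfD /= coeft_var IH -/(cochain _ _ _).
by apply: congr1; apply: eq_bigr => j _; rewrite coeft_shift /bump add1n subSS.
Qed.

(** The coefficient of t^n in the associativity law of the deformed product. *)
Lemma cochain_assoc n a b c :
  \sum_(j < n.+1) cochain (n - j) (cochain j a b) c
  = \sum_(j < n.+1) cochain (n - j) a (cochain j b c).
Proof.
apply: eq_trans (esym (coeft_mul_embed n (embed a * embed b) c)) _.
apply: eq_trans _ (coeft_embed_mul n a (embed b * embed c)).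
exact: congr1 (esym (mulrA _ _ _)).
Qed.

Lemma cochain_poly n p a b : cochain n (gwa_poly _ _ p * a) b = gwa_poly _ _ p * cochain n a b.
Proof.
by rewrite /cochain !gwa_poly_mul embed_polyM gwa_mulZl coeft_polyM.
Qed.

Lemma cochain1l n a : (0 < n)%N -> cochain n 1 a = 0.
Proof.
by case: n => // n _; rewrite /cochain (embed_xpow 0) -[et_ 0]/(1 : BT) mul1r coeft_embed.
Qed.
Lemma cochain1r n a : (0 < n)%N -> cochain n a 1 = 0.
Proof.
by case: n => // n _; rewrite /cochain (embed_xpow 0) -[et_ 0]/(1 : BT) mulr1 coeft_embed.
Qed.

Lemma embed_x : embed (gwa_x _ _) = gwa_x _ _. Proof. exact: embed_xpow. Qed.
Lemma embed_y : embed (gwa_y _ _) = gwa_y _ _. Proof. exact: embed_xpow. Qed.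
Lemma embed_poly p : embed (gwa_poly _ _ p) = gwa_poly _ _ (map_poly (@pconst k) p).
Proof. by rewrite /gwa_poly embed_polyM embed_xpow. Qed.
Lemma coeft_poly n p :
  coeft n (gwa_poly _ _ p) = gwa_poly _ _ (map_poly (@pcoef k n) p).
Proof. exact: malg_mapU. Qed.
Lemma embed_z : embed (gwa_z _ _) = gwa_z _ _.
Proof. by rewrite /gwa_z embed_poly map_polyX. Qed.

Lemma embed_x_exp m : embed (gwa_x _ _ ^+ m) = gwa_x _ _ ^+ m.
Proof. by rewrite !gwa_x_exp embed_xpow. Qed.
Lemma embed_y_exp m : embed (gwa_y _ _ ^+ m) = gwa_y _ _ ^+ m.
Proof. by case: m => [|m]; rewrite ?gwa_y_exp; apply: embed_xpow. Qed.

Lemma cochain_x_exp n i j : (0 < n)%N -> cochain n (gwa_x _ _ ^+ i) (gwa_x _ _ ^+ j) = 0.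
Proof.
by case: n => // n _; rewrite /cochain !embed_x_exp -exprD -embed_x_exp coeft_embed.
Qed.
Lemma cochain_y_exp n i j : (0 < n)%N -> cochain n (gwa_y _ _ ^+ i) (gwa_y _ _ ^+ j) = 0.
Proof.
by case: n => // n _; rewrite /cochain !embed_y_exp -exprD -embed_y_exp coeft_embed.
Qed.

Lemma embed_zM a : embed (gwa_z _ _ * a) = gwa_z _ _ * embed a.
Proof. by rewrite /gwa_z !gwa_poly_mul embed_polyM map_polyX. Qed.

Lemma cochain_xz n :
  cochain n (gwa_x _ _) (gwa_z _ _) =
  (if n is m.+1 then (if m is 0 then -1 else 0) else 1) *: (gwa_x _ _ * gwa_z _ _).
Proof.
rewrite /cochain embed_x embed_z gwa_xz -embed_x -embed_zM.
by rewrite coeft_Zembed pcoef_mu gwa_xz scalerA mulrC.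
Qed.

Lemma cochain_yz n :
  cochain n (gwa_y _ _) (gwa_z _ _) = gwa_y _ _ * gwa_z _ _.
Proof.
rewrite /cochain embed_y embed_z gwa_yz -embed_y -embed_zM.
by rewrite coeft_Zembed gwa_yz.
Qed.

Lemma cochain_yx n : (0 < n)%N -> cochain n (gwa_y _ _) (gwa_x _ _) = 0.
Proof.
by case: n => // n _; rewrite /cochain embed_x embed_y gwa_yx -embed_poly coeft_embed.
Qed.

Lemma pcoef_muX n i : pcoef n (mu_t ^+ i) = lam ^+ i * ((-1) ^+ n * 'C(i, n)%:R).
Proof.
rewrite /mu_t exprMn -rmorphXn /= pcoef_constM; congr (_ * _); exact: pcoef_geometric.
Qed.

(** In the deformed algebra x y = phi(lam (1 - t) z), and the coefficient of
    (1 - t)^i at t^n is the signed binomial coefficient of i and n. *)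
Lemma cochain_xy n : cochain n (gwa_x _ _) (gwa_y _ _) =
  (-1) ^+ n *: (gwa_z _ _ ^+ n * gwa_poly _ _ (dilate lam phi)^`N(n)).
Proof.
rewrite /cochain embed_x embed_y gwa_xy coeft_poly gwa_z_exp -gwa_polyM -gwa_polyZ.
congr gwa_poly; apply/polyP => i.
rewrite coef_map /= coef_dilate coef_map /= mulrC pcoef_constM pcoef_muX.
rewrite coefZ coefXnM coef_nderivn coef_dilate.
case: ltnP => [lt_in|le_ni]; first by rewrite bin_small // !mulr0.
by rewrite subnKC // -[(lam ^+ i * _) *+ _]mulr_natr mulrA [phi`_i * _]mulrC mulrCA.
Qed.

End Deformation.

(** * Degree bounds, spanning, and rigidity of normalized cocycles *)

Section DegreeBound.
Variable R : comNzRingType.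
Implicit Types p c : {poly R}.

(** A polynomial of degree at most n - w.  The test is on coefficients, because
    n - w may be negative, and the polynomial must then be zero. *)
Definition coef_bound (n w : nat) p := forall i, (n < i + w)%N -> p`_i = 0.

Lemma coef_bound_le n w n' w' p :
  (n + w' <= n' + w)%N -> coef_bound n w p -> coef_bound n' w' p.
Proof.
move=> le pb i lt; apply: pb; rewrite -(ltn_add2r w').
by apply: leq_ltn_trans le _; rewrite addnAC ltn_add2r.
Qed.

Lemma coef_boundM n w d p c :
  coef_bound n w p -> coef_bound d 0 c -> coef_bound (n + d) w (p * c).
Proof.
move=> pb cb i lt; rewrite coefM big1 // => j _.
have [le|gt] := leqP (j + w) n; last by rewrite pb ?mul0r.
rewrite cb ?mulr0 // addn0; have le_ji : (j <= i)%N by rewrite -ltnS.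
rewrite -(ltn_add2r (j + w)) (addnA (i - j)%N) subnK //.
by apply: leq_ltn_trans lt; rewrite addnC leq_add2r.
Qed.

Lemma coef_bound_dilate n w (e : R) p : coef_bound n w p -> coef_bound n w (dilate e p).
Proof. by move=> pb i lt; rewrite coef_dilate pb ?mulr0. Qed.

Variables (mu nu : R) (phi : {poly R}) (l : nat).
Hypothesis phi_bound : coef_bound l 0 phi.
Local Notation W := {malg {poly R}[int]}.

(** The n-th step of the filtration by weight, where z^p x_q has weight
    p + (l + 1) |q|. *)
Definition filtered (n : nat) (a : W) := forall q, coef_bound n (l.+1 * `|q|%N) a@_q.

Lemma filteredD n a b : filtered n a -> filtered n b -> filtered n (a + b).
Proof. by move=> fa fb q i lt; rewrite mcoeffD coefD fa // fb // addr0. Qed.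

Lemma filtered0 n : filtered n 0.
Proof. by move=> q i _; rewrite mcoeff0 coef0. Qed.

Lemma filtered_monomial n p q :
  coef_bound n (l.+1 * `|q|%N) p -> filtered n (p *: << 1 *g q >>).
Proof.
move=> pb j i; rewrite malgZU mulr1 mcoeffU.
by case: eqP => [<-|_] lt; rewrite ?coef0 // pb.
Qed.

Lemma filtered_semilift n m (s : {rmorphism {poly R} -> {poly R}}) (h : int -> W) a :
    (forall q p, coef_bound n (l.+1 * `|q|%N) p -> filtered m (s p *: h q)) ->
  filtered n a -> filtered m (semilift s h a).
Proof.
move=> hb fa; rewrite /semilift /malg_lift.
by elim/big_rec: _ => [|q b _ fb]; [apply: filtered0|apply: filteredD => //; apply: hb; apply: fa].
Qed.

(** For q >= 0 the product x x_q adds l + 1 through |q|.  For q < 0 it removes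
    l + 1 through |q|, while the factor sigma phi adds at most l to the degree. *)
Lemma filtered_left_x n a : filtered n a -> filtered (n + l.+1) (left_x (dilate mu) phi a).
Proof.
apply: filtered_semilift => q p pb.
have sb : coef_bound n (l.+1 * `|q|) (dilate mu p) by apply: coef_bound_dilate.
have sbM := coef_boundM sb (coef_bound_dilate mu phi_bound).
case: q {pb} sb sbM => [j|[|j]] sb sbM; rewrite /= ?scalerA; apply: filtered_monomial.
- by apply: coef_bound_le sb; rewrite /= mulnS addnA.
- by apply: coef_bound_le sbM; rewrite /= muln0 addn0 -addnA leq_add2l ltnW // ltn_addr.
- apply: coef_bound_le sbM; rewrite /= leq_add //; first by rewrite leq_add2l.
  by rewrite leq_mul2l leqnSn orbT.
Qed.

Lemma filtered_left_y n a : filtered n a -> filtered (n + l.+1) (left_y (dilate nu) phi a).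
Proof.
apply: filtered_semilift => q p pb.
have sb : coef_bound n (l.+1 * `|q|) (dilate nu p) by apply: coef_bound_dilate.
have sbM := coef_boundM sb phi_bound.
case: q {pb} sb sbM => [[|j]|j] sb sbM; rewrite /= ?scalerA; apply: filtered_monomial.
- by apply: coef_bound_le sb; rewrite /= muln0 muln1 addn0.
- apply: coef_bound_le sbM; rewrite /= leq_add //; first by rewrite leq_add2l.
  by rewrite leq_mul2l leqnSn orbT.
- by apply: coef_bound_le sb; rewrite /= [(l.+1 * j.+2)%N]mulnS addnA.
Qed.

Lemma filtered_left_xq n q a :
  filtered n a -> filtered (n + l.+1 * `|q|) (left_xq (dilate mu) (dilate nu) phi q a).
Proof.
move=> fa; case: q => m /=.
  elim: m => [|m IH]; first by rewrite muln0 addn0.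
  by rewrite mulnS addnCA addnC; apply: filtered_left_x.
elim: m => [|m IH]; first by rewrite muln1; apply: filtered_left_y.
by rewrite mulnS addnCA addnC; apply: filtered_left_y.
Qed.

Lemma filteredZ n d c a : coef_bound d 0 c -> filtered n a -> filtered (n + d) (c *: a).
Proof. by move=> cb fa q; rewrite mcoeffZ mulrC; apply: coef_boundM. Qed.

Lemma coef_bound_Xn n : coef_bound n 0 ('X^n : {poly R}).
Proof. by move=> i; rewrite addn0 coefXn => /gtn_eqF ->. Qed.
End DegreeBound.

Section Filtration.
Variables (k : fieldType) (lam : k) (lam_unit : lam * lam^-1 = 1) (phi : {poly k}).
Local Notation B := (gwa lam_unit phi).
Local Notation l := (size phi).-1.
Local Notation T := (pseries k).

Lemma coef_bound_size (R : comNzRingType) (p : {poly R}) : coef_bound (size p).-1 0 p.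
Proof. by move=> i lt; apply: nth_default; move: lt; rewrite addn0; case: size. Qed.

Lemma filtered_cochain n p q r s :
  filtered l ((p + l.+1 * `|q|) + (r + l.+1 * `|s|))
    (@cochain k lam lam_unit phi n ('X^p *: (gwa_xpow lam_unit phi q : {malg _[_]}))
               ('X^r *: (gwa_xpow lam_unit phi s : {malg _[_]}))).
Proof.
rewrite /cochain !embed_polyM !embed_xpow !map_polyXn.
set w := _ * _; suff fw : filtered l (p + l.+1 * `|q| + (r + l.+1 * `|s|)) w.
  by move=> j i lt; rewrite /coeft mcoeff_malg_map /= coef_map fw.
rewrite /w gwa_mulZl gwa_mulE star_basis [(_ + _ + _)%N]addnC (addnC p) addnA.
apply: filteredZ (@coef_bound_Xn _ _) _; apply: filtered_left_xq.
  by move=> i lt; rewrite coef_map coef_bound_size ?raddf0.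
by apply: filtered_monomial => i lt; rewrite coefXn gtn_eqF // -(ltn_add2r (l.+1 * `|s|)).
Qed.

Variables (A : algType k) (x y z : A).

Lemma in_Gamma_realize n (a : B) : filtered l n a -> in_Gamma phi x y z n (realize x y z a).
Proof.
move=> fa; rewrite /realize /malg_lift.
have G0 : in_Gamma phi x y z n 0 by exists [::]; rewrite ?big_nil.
have GD u v : in_Gamma phi x y z n u -> in_Gamma phi x y z n v -> in_Gamma phi x y z n (u + v).
  by case=> su Hu -> [sv Hv ->]; exists (su ++ sv); rewrite ?all_cat ?Hu ?big_cat.
elim/big_ind: _ => // q _; rewrite /realize_term.
rewrite -[a@_q]coefK poly_def raddf_sum; elim/big_ind: _ => // i _.
rewrite /= /realize_term -mul_polyC rmorphM rmorphXn /= horner_algX horner_algC mulr_algl.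
have -> : (a@_q)`_i *: z ^+ i * xq x y q = (a@_q)`_i *: basis_elt x y z (i : nat, q).
  by rewrite -scalerAl.
have [le|gt] := leqP (weight phi (i : nat, q)) n; last by rewrite fa ?scale0r.
by exists [:: ((a@_q)`_i, (i : nat, q))]; rewrite /= ?le ?big_seq1.
Qed.

Lemma realize_basis p q :
  realize x y z ('X^p *: (gwa_xpow lam_unit phi q : {malg _[_]}) : B) = basis_elt x y z (p, q).
Proof. by rewrite realizeU rmorphXn /= horner_algX. Qed.

(** Induction on elements of A, seen as combinations of the z^p x_q. *)
Lemma span_ind (P : A -> Prop) : P 0 -> (forall u v, P u -> P v -> P (u + v)) ->
    (forall c u, P u -> P (c *: u)) -> (forall p q, P (z ^+ p * xq x y q)) ->
  forall a : B, P (realize x y z a).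
Proof.
move=> P0 PD PZ Pb a; rewrite /realize /malg_lift.
elim/big_ind: _ => // q _; rewrite /realize_term.
rewrite -[a@_q]coefK poly_def raddf_sum; elim/big_ind: _ => // i _.
by rewrite /= /realize_term -mul_polyC rmorphM rmorphXn /= horner_algX horner_algC mulr_algl -scalerAl; apply: PZ.
Qed.
End Filtration.

Section Rigidity.
Variables (k : fieldType) (lam : k) (phi : {poly k}).
Variables (A : algType k) (x y z : A).
Hypothesis rel : gwa_relations lam phi x y z.
Hypothesis basis_ind : forall P : A -> Prop,
  P 0 -> (forall u v, P u -> P v -> P (u + v)) ->
  (forall c u, P u -> P (c *: u)) -> (forall p q, P (z ^+ p * xq x y q)) -> forall a, P a.

Section Cocycle.
Variable D : {bilinear A -> A -> A}.
Hypotheses (D_cocycle : cocycle2 D) (D_norm : cond_a D) (D_b : cond_b x y z D).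
Hypotheses (D_xz : D x z = 0) (D_yz : D y z = 0) (D_xy : D x y = 0) (D_yx : D y x = 0).

Lemma cocycle_hornerl p u v : D (horner_alg z p * u) v = horner_alg z p * D u v.
Proof.
elim/poly_ind: p u => [|p c IH] u; first by rewrite raddf0 !mul0r linear0l.
rewrite rmorphD rmorphM /= horner_algX horner_algC !mulrDl linearDl -!mulrA IH.
by rewrite D_b.1 -!scalerAl !mul1r linearZl_LR.
Qed.

Lemma cocycle_horner1l p v : D (horner_alg z p) v = 0.
Proof. by rewrite -[horner_alg z p]mulr1 cocycle_hornerl (D_norm 1 v).2 mulr0. Qed.

(** The cocycle identity for (u, v, w), when its last term vanishes. *)
Lemma cocycle_mulr u v w : D u v = 0 -> D u (v * w) = D (u * v) w - u * D v w.
Proof.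
move=> uv0; have /eqP := D_cocycle u v w; rewrite /hochschild_b uv0 mul0r subr0.
by rewrite addr_eq0 => /eqP h; rewrite -[LHS]opprK -h opprB.
Qed.

(** The cocycle identity for (w, z, v), where w is x or y. *)
Lemma cocycle_zr w c v : w * z = c *: (z * w) -> D w z = 0 -> D w (z * v) = c *: (z * D w v).
Proof.
move=> wz wz0; have := cocycle_horner1l 'X v; rewrite horner_algX => Dzv.
by rewrite cocycle_mulr // Dzv mulr0 subr0 wz linearZl_LR D_b.1.
Qed.

Lemma cocycle_gen_eq0 w c : w * z = c *: (z * w) -> D w z = 0 ->
  (forall q, D w (xq x y q) = 0) -> forall v, D w v = 0.
Proof.
move=> wz wz0 w_b; apply: basis_ind => [|u v Du Dv|a u Du|p q].
- exact: linear0r.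
- by rewrite linearDr Du Dv addr0.
- by rewrite linearZr_LR Du scaler0.
elim: p => [|p IH]; first by rewrite mul1r.
by rewrite exprS -mulrA (cocycle_zr _ wz) // IH mulr0 scaler0.
Qed.

(** By [cocycle_gen_eq0] only D(x, x_q) is at stake.  For q >= 0 it is zero by
    (b); for q < 0 the cocycle identity for (x, y, y^j) expresses it by D(x y, y^j)
    and D(y, y^j), and x y is a polynomial in z. *)
Lemma cocycle_x_eq0 v : D x v = 0.
Proof.
have [xz _ _ xy] := rel; apply: (cocycle_gen_eq0 xz) => // q.
have [_ D_pow] := D_b.
rewrite /xq; case: ifP => _; first by have [] := D_pow 1%N `|q|%N.
case: `|q|%N => [|j]; first by rewrite (D_norm x 1).1.
by rewrite exprS cocycle_mulr // xy cocycle_horner1l (D_pow 1%N j).2 mulr0 subr0.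
Qed.

Lemma cocycle_y_eq0 v : D y v = 0.
Proof.
have [_ yz yx _] := rel; apply: (cocycle_gen_eq0 yz) => // q.
have [_ D_pow] := D_b.
rewrite /xq; case: ifP => _; last by have [] := D_pow 1%N `|q|%N.
case: `|q|%N => [|j]; first by rewrite (D_norm y 1).1.
by rewrite exprS cocycle_mulr // yx cocycle_horner1l (D_pow 1%N j).1 mulr0 subr0.
Qed.

Lemma cocycle_genM w u v : (forall v, D w v = 0) -> D (w * u) v = w * D u v.
Proof. by move=> w0; apply/eqP; rewrite -subr_eq0 -cocycle_mulr ?w0. Qed.

(** Since D vanishes when its first argument is x or y, it commutes with left
    multiplication by x and y there, as it does for z; so it is determined by
    D(1, v), which is zero. *)
Lemma normalized_cocycle_eq0 u v : D u v = 0.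
Proof.
apply: (basis_ind (P := fun u => D u v = 0)) => [|a b Da Db|c a Da|p q].
- exact: linear0l.
- by rewrite linearDl Da Db addr0.
- by rewrite linearZl_LR Da scaler0.
have -> : z ^+ p = horner_alg z 'X^p by rewrite rmorphXn /= horner_algX.
rewrite cocycle_hornerl; suff -> : D (xq x y q) v = 0 by rewrite mulr0.
by rewrite /xq; case: ifP => _; elim: `|q|%N => [|j IH]; rewrite ?(D_norm 1 v).2 //
  exprS cocycle_genM ?IH ?mulr0 //; [exact: cocycle_x_eq0|exact: cocycle_y_eq0].
Qed.
End Cocycle.

Lemma cochain_unique (F G : {bilinear A -> A -> A}) :
    (forall a b c, hochschild_b F a b c = hochschild_b G a b c) ->
    cond_a F -> cond_a G -> cond_b x y z F -> cond_b x y z G ->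
    [/\ F x z = G x z, F y z = G y z, F x y = G x y & F y x = G y x] ->
  F =2 G.
Proof.
move=> bFG Fa Ga [Fz Fp] [Gz Gp] [xz yz xy yx] u v; apply/eqP; rewrite -subr_eq0; apply/eqP.
pose d a b := F a b - G a b.
have d_bilinear : bilinear_for (GRing.Scale.Law.clone _ _ *:%R _) (GRing.Scale.Law.clone _ _ *:%R _) d.
  split=> w c a b; rewrite /d; first by rewrite !linearPl /= scalerBr opprD addrACA.
  by rewrite !linearPr /= scalerBr opprD addrACA.
pose D : {bilinear A -> A -> A} := HB.pack d (bilinear_isBilinear.Build _ _ _ _ _ _ d d_bilinear).
have DE a b : D a b = F a b - G a b by [].
rewrite -[LHS]DE; apply: normalized_cocycle_eq0; rewrite ?DE.
- move=> a b c; have /eqP := bFG a b c; rewrite -subr_eq0 => /eqP <-.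
  rewrite /hochschild_b !DE mulrBr mulrBl !opprB !opprD !opprK.
  by rewrite !addrA [RHS](AC 8 (1*6*7*2*3*8*5*4)).
- by move=> a b; rewrite !DE (Fa a b).1 (Ga a b).1 (Fa a b).2 (Ga a b).2 subrr.
- split=> [a b|q j]; first by rewrite !DE Fz Gz mulrBr.
  by rewrite !DE (Fp q j).1 (Fp q j).2 (Gp q j).1 (Gp q j).2 subrr.
- by rewrite xz subrr.
- by rewrite yz subrr.
- by rewrite xy subrr.
- by rewrite yx subrr.
Qed.
End Rigidity.

(** * Integration of the first cocycle *)

Lemma telescope_rearrange (V : zmodType) (p q r s t : V) :
  p - q + t + (r - s) = 0 -> t = s - p + q - r.
Proof.
move/eqP; rewrite addrAC addrC addr_eq0 => /eqP ->.
by rewrite !opprD !opprK !addrA [LHS](AC 4 (4*1*2*3)).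
Qed.

Section Integration.
Variables (k : fieldType) (lam : k) (lam_unit : lam * lam^-1 = 1) (phi : {poly k}).
Local Notation B := (gwa lam_unit phi).

(** In [cochain_assoc], the terms in which one of the two maps is the product
    itself, that is j = 0 and j = n, form the Hochschild coboundary. *)
Lemma cochain_integrates n (a b c : B) : (0 < n)%N ->
  \sum_(1 <= i < n) bullet (@cochain k lam lam_unit phi i) (cochain (n - i)) a b c
  = hochschild_b (cochain n) a b c.
Proof.
case: n => // n _; rewrite big_nat_rev /=.
pose G j := cochain (n.+1 - j) (cochain j a b) c - cochain (n.+1 - j) a (cochain j b c).
rewrite (eq_big_nat _ _ (F2 := G)); last first.
  by move=> i /andP[i0 lei]; rewrite add1n subSS /G /bullet subKn // leqW // ltnW.
have : \sum_(0 <= j < n.+2) G j = 0.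
  rewrite big_mkord /G sumrB; apply/eqP; rewrite subr_eq0; apply/eqP.
  exact: (cochain_assoc n.+1 a b c).
rewrite (@big_nat_recr _ _ _ n.+1 0) // big_ltn //=.
have -> : G 0%N = cochain n.+1 (a * b) c - cochain n.+1 a (b * c).
  by rewrite /G subn0 !cochain0.
have -> : G n.+1 = cochain n.+1 a b * c - a * cochain n.+1 b c.
  by rewrite /G subnn !cochain0.
exact: telescope_rearrange.
Qed.

Lemma cochain_cond_a n : (0 < n)%N -> cond_a (@cochain k lam lam_unit phi n).
Proof. by move=> n0 a b; split; [apply: cochain1r|apply: cochain1l]. Qed.

Lemma cochain_cond_b n : (0 < n)%N ->
  cond_b (gwa_x _ _) (gwa_y _ _) (gwa_z _ _) (@cochain k lam lam_unit phi n).
Proof.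
move=> n0; split=> [a b|i j]; first exact: cochain_poly.
by split; [apply: cochain_x_exp|apply: cochain_y_exp].
Qed.
End Integration.

Section Transport.
Variables (k : fieldType) (A B : algType k).
Variables (rho : {lrmorphism A -> B}) (psi : {lrmorphism B -> A}).
Hypotheses (rhoK : cancel rho psi) (psiK : cancel psi rho).

(** Cochains are carried from the explicit algebra to A along an isomorphism. *)
Definition transport (C : B -> B -> B) (a b : A) : A := psi (C (rho a) (rho b)).

Lemma transport_bilinear (C : B -> B -> B) :
  bilinear_for (GRing.Scale.Law.clone _ _ *:%R _) (GRing.Scale.Law.clone _ _ *:%R _) C ->
  bilinear_for (GRing.Scale.Law.clone _ _ *:%R _) (GRing.Scale.Law.clone _ _ *:%R _) (transport C).
Proof.
move=> [Cl Cr]; split=> u c a b; rewrite /transport linearP.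
  by rewrite (Cl (rho u)) linearP.
by rewrite (Cr (rho u)) linearP.
Qed.

Lemma transport_psi C u v : transport C (psi u) (psi v) = psi (C u v).
Proof. by rewrite /transport !psiK. Qed.

Lemma transport_bullet C C' a b c :
  bullet (transport C) (transport C') a b c = psi (bullet C C' (rho a) (rho b) (rho c)).
Proof. by rewrite /bullet /transport !psiK raddfB. Qed.

Lemma transport_hochschild C a b c :
  hochschild_b (transport C) a b c = psi (hochschild_b C (rho a) (rho b) (rho c)).
Proof.
by rewrite /hochschild_b /transport !(raddfB, raddfD) /= !rmorphM /= !rhoK.
Qed.

Lemma transport_cond_a C : cond_a C -> cond_a (transport C).
Proof.
move=> Ca u v; rewrite /transport rmorph1.
by have [-> _] := Ca (rho u) 0; have [_ ->] := Ca 0 (rho v); rewrite raddf0.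
Qed.

Lemma transport_cond_b C x y z :
  cond_b x y z C -> cond_b (psi x) (psi y) (psi z) (transport C).
Proof.
move=> [Cz Cp]; split=> [u v|q j].
  by rewrite /transport rmorphM /= psiK Cz rmorphM.
by rewrite -!rmorphXn /= !transport_psi (Cp q j).1 (Cp q j).2 raddf0.
Qed.
End Transport.

Theorem theorem5p3 (k : fieldType) (char0 : [pchar k] =i pred0)
    (lam : k) (lam_neq0 : lam != 0) (lam_neq1 : lam != 1)
    (phi : {poly k}) (phi_neq0 : phi != 0)
    (A : algType k) (x y z : A) (A_gwa : is_gwa lam phi x y z)
    (F1 : {bilinear A -> A -> A}) (F1_def : is_F1 lam phi x y z F1) :
  exists F : nat -> {bilinear A -> A -> A},
    [/\ integrating_family lam phi x y z F1 F,
        (forall G : nat -> {bilinear A -> A -> A},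
           integrating_family lam phi x y z F1 G ->
           forall n : nat, (2 <= n)%N -> G n =2 F n)
      & forall n : nat, (2 <= n)%N -> preserves_Gamma phi x y z (F n)].
Proof.
have lam_unit : lam * lam^-1 = 1 by rewrite divff.
have rel : gwa_relations lam phi x y z by case: A_gwa.
have [rho [rx ry rz rhoK psiK]] := gwa_presentation lam_unit A_gwa.
have [psi psiE] := realize_lrmorphism lam_unit rel.
have {}rhoK : cancel rho psi by move=> a; rewrite psiE.
have {}psiK : cancel psi rho by move=> a; rewrite psiE.
have basis_ind (P : A -> Prop) : P 0 -> (forall u v, P u -> P v -> P (u + v)) ->
    (forall c u, P u -> P (c *: u)) -> (forall p q, P (z ^+ p * xq x y q)) -> forall a, P a.
  move=> P0 PD PZ Pb a; rewrite -[a]rhoK psiE; exact: span_ind.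
have psi_gens : [/\ psi (gwa_x _ _) = x, psi (gwa_y _ _) = y & psi (gwa_z _ _) = z].
  by rewrite -rx -ry -rz.
have [px py pz] := psi_gens.
have psi_poly p : psi (gwa_poly _ _ p) = horner_alg z p.
  by rewrite psiE realizeU mulr1.
pose f n := transport rho psi (@cochain k lam lam_unit phi n).
have f_bilinear n := transport_bilinear rho psi (cochain_bilinear lam_unit phi n).
pose F n : {bilinear A -> A -> A} := HB.pack (f n) (bilinear_isBilinear.Build _ _ _ _ _ _ (f n) (f_bilinear n)).
have F_integrates n a b c : (0 < n)%N ->
    \sum_(1 <= i < n) bullet (F i) (F (n - i)%N) a b c = hochschild_b (F n) a b c.
  move=> n0; rewrite (transport_hochschild rhoK) -cochain_integrates // raddf_sum.
  by apply: eq_bigr => i _; rewrite (transport_bullet psiK).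
have F_a n : (0 < n)%N -> cond_a (F n).
  by move=> n0; apply/transport_cond_a/cochain_cond_a.
have F_b n : (0 < n)%N -> cond_b x y z (F n).
  by move=> n0; rewrite -px -py -pz; apply/(transport_cond_b psiK)/cochain_cond_b.
have F_values n : (0 < n)%N ->
  [/\ F n x z = (if n == 1%N then - (x * z) else 0), F n y z = y * z,
      F n x y = ((-1) ^+ n / (n`!)%:R) *: (z ^+ n * horner_alg z (sigma lam phi)^`(n))
    & F n y x = 0].
  move=> n0; have FE u v a b : psi u = a -> psi v = b -> F n a b = psi (cochain n u v).
    by move=> <- <-; apply: (transport_psi psiK).
  rewrite (FE _ _ _ _ px pz) (FE _ _ _ _ py pz) (FE _ _ _ _ px py) (FE _ _ _ _ py px).
  rewrite cochain_xz cochain_yz cochain_xy cochain_yx // raddf0.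
  split=> //.
  - rewrite linearZ rmorphM /= px pz.
    by case: n n0 {FE} => [|[|n]] //= _; rewrite ?scaleN1r ?scale0r.
  - by rewrite rmorphM /= py pz.
  rewrite linearZ rmorphM rmorphXn /= pz psi_poly nderivn_def raddfMn /= mulrnAr.
  rewrite -[(_ * _) *+ _]scaler_nat scalerA divfK //.
  by have /pcharf0P -> := char0; rewrite -lt0n fact_gt0.
have FE n a b : F n a b = psi (cochain n (rho a) (rho b)) by [].
clearbody F.
have rigid := cochain_unique rel basis_ind.
case: F1_def => F1_cocycle F1_a F1_b [F1xz F1yz F1xy F1yx].
(* At order 1 the integration equation has an empty left-hand side, so F 1 is
   a cocycle, with the same normalization and values as F1. *)
have F1E : F 1%N =2 F1.
  apply: rigid => //; [move=> a b c|exact: F_a|exact: F_b|].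
    by rewrite F1_cocycle -F_integrates // big_geq.
  have [-> -> -> ->] := F_values 1%N isT; rewrite F1xz F1yz F1xy F1yx; split=> //.
  by rewrite [1`!%:R](_ : _ = 1) // divr1 !expr1 scaleN1r derivn1.
exists F; split.
- split; first by split=> // n n2 a b c; apply: F_integrates; apply: ltnW.
  move=> n n2; have n0 := ltnW n2; split; [exact: F_a|exact: F_b|].
  by have [xz yz xy yx] := F_values n n0; split=> //; rewrite xz gtn_eqF.
- move=> G [[G1 G_int] G_cond].
  suff GE n : (0 < n)%N -> G n =2 F n by move=> n n2; apply: GE; apply: ltnW.
  elim/ltn_ind: n => n IH n0.
  have [n2|le1] := ltnP 1 n; last first.
    have -> : n = 1%N by apply/eqP; rewrite eqn_leq le1 n0.
    by move=> a b; rewrite G1 F1E.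
  have [Ga Gb [Gxz Gyz Gxy Gyx]] := G_cond n n2.
  apply: rigid => //; [move=> a b c|exact: F_a|exact: F_b|].
    rewrite -G_int // -F_integrates //; apply: eq_big_nat => i /andP[i0 lt_in].
    have ni0 : (0 < n - i)%N by rewrite subn_gt0.
    have lt_ni : (n - i < n)%N by rewrite ltn_subrL i0.
    by rewrite /bullet !(IH _ lt_in i0) !(IH _ lt_ni ni0).
  have [xz yz xy yx] := F_values n n0.
  by split; rewrite ?Gxz ?Gyz ?Gxy ?Gyx ?xz ?yz ?xy ?yx // gtn_eqF.
move=> n n2 [p q] [r s].
have rho_basis p' q' : rho (basis_elt x y z (p', q')) = 'X^p' *: (gwa_xpow lam_unit phi q' : {malg _[_]}).
  by rewrite -(realize_basis lam_unit phi) -psiE psiK.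
rewrite FE !rho_basis psiE.
by apply: in_Gamma_realize; apply: filtered_cochain.
Qed.
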